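(* Let $m\ge0$ and $n\in N(m)$. Then the family $(\mathrm{ss}_{\lambda,n}\mid \lambda\text{ a partition of }m)$ is linearly independent over $\mathbb C$.
   Context: $N(m)=\{n\ge m: n\equiv m\pmod 2\}$. A skew shape is a horizontal strip if it has at most one box in each column. An SSOT of shape $\lambda$ is a sequence of partitions $S=(S^1,S'^2,S^2,S'^3,\dots)$ such that, with $S^0=S'^1=\emptyset$: for all $i\ge1$, $S'^i\subseteq S^{i-1}$, $S'^i\subseteq S^i$, and $S^{i-1}/S'^i$, $S^i/S'^i$ are horizontal strips (possibly empty); and $S^i=S'^{i+1}=\lambda$ for all large $i$. Put $m_i(S)=|S^{i-1}/S'^i|+|S^i/S'^i|$, length $n=\sum_i m_i(S)$, $x^S=\prod_ix_i^{m_i(S)}$. $\mathrm{ss}_{\lambda,n}(x)=\sum x^S$ over SSOTs of shape $\lambda$ and length $n$, in infinitely many variables. *)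

(* Defs.v *)
From HB Require Import structures.
From mathcomp Require Import all_boot all_order all_algebra.
From mathcomp Require Import finmap complex.
From mathcomp Require Import boolp classical_sets functions cardinality fsbigop.
From mathcomp Require Import reals.

Set Implicit Arguments.
Unset Strict Implicit.
Unset Printing Implicit Defensive.

Import GRing.Theory.
Local Open Scope classical_set_scope.

Record intpart : Type := IntPart {
  parts :> seq nat;
  _ : sorted geq parts && (0 \notin parts) }.

HB.instance Definition _ := [isSub for parts].
HB.instance Definition _ := [Choice of intpart by <:].

Definition intpart0 : intpart := @IntPart [::] isT.

Definition intpart_of (m : nat) : Type := {la : intpart | sumn la == m}.
HB.instance Definition _ (m : nat) := Equality.on (intpart_of m).

Definition part_sub (mu la : intpart) : Prop :=
  forall r : nat, nth 0 mu r <= nth 0 la r.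

(* [skew la mu] is the set of boxes (row, column) of la/mu, indexed from 0. *)
Definition skew (la mu : intpart) : set (nat * nat) :=
  [set b | nth 0 mu b.1 <= b.2 < nth 0 la b.1].

Definition horizontal_strip (la mu : intpart) : Prop :=
  forall c r1 r2 : nat,
    skew la mu (r1, c) -> skew la mu (r2, c) -> r1 = r2.

(* Only meaningful when [part_sub mu la]. *)
Definition skew_size (la mu : intpart) : nat := sumn la - sumn mu.

(* A pair S encodes the interleaved sequence (S^1, S'^2, S^2, S'^3, ...),
   prefixed by S^0 and S'^1: S^i is [S.1 i] and S'^(i+1) is [S.2 i]. *)
Definition tabseq : Type := ((nat -> intpart) * (nat -> intpart))%type.

Definition is_ssot (la : intpart) (S : tabseq) : Prop :=
  [/\ S.1 0 = intpart0,
      S.2 0 = intpart0,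
      forall i : nat, part_sub (S.2 i) (S.1 i) /\ part_sub (S.2 i) (S.1 i.+1),
      forall i : nat, horizontal_strip (S.1 i) (S.2 i) /\
                      horizontal_strip (S.1 i.+1) (S.2 i)
    & exists N : nat, forall i : nat, N <= i -> S.1 i = la /\ S.2 i = la].

(* The multiplicity m_(i+1)(S). *)
Definition ssot_mult (S : tabseq) (i : nat) : nat :=
  skew_size (S.1 i) (S.2 i) + skew_size (S.1 i.+1) (S.2 i).

(* For an SSOT only finitely many multiplicities are nonzero. *)
Definition ssot_length (S : tabseq) : nat :=
  \big[addn/0]_(i \in [set: nat]) ssot_mult S i.

(* Exponent vectors of monomials in x_1, x_2, ...; index i stands for
   x_(i+1). *)
Definition expvec : Type := {fsfun nat -> nat with 0}.

(* Formal power series in infinitely many variables, given by their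
   coefficients; the module structure is pointwise. *)
Definition powser (K : comNzRingType) : lmodType K := (expvec -> K^o).

(* The coefficient of x^alpha is the number of SSOTs S with x^S = x^alpha;
   there are finitely many of them, so [fset_set] does not truncate. *)
Definition ss (K : comNzRingType) (la : intpart) (n : nat) : powser K :=
  fun alpha : expvec =>
    (#|` fset_set [set S : tabseq | [/\ is_ssot la S, ssot_length S = n
                                     & forall i : nat,
                                         ssot_mult S i = alpha i]]|%fset)%:R%R.

Definition lin_indep (K : nzRingType) (V : lmodType K) (I : eqType)
    (v : I -> V) : Prop :=
  forall (s : seq I) (c : I -> K), uniq s ->
    (\sum_(i <- s) c i *: v i = 0)%R -> forall i : I, i \in s -> c i = 0%R.

(* Main.v *)
(** Write [n = m + 2k].  In an SSOT of shape [mu] and length [n], exactly [k]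
    boxes are removed altogether, none of them in the first step, and [S^j]
    has at most [j] rows.  Counting boxes, [m_1 + ... + m_j] is at most
    [mu_1 + ... + mu_j + min(j,2) k], so if [x^S] equals the monomial
    [x^la (x_1 x_2)^k] then [la] is dominated by [mu].  Since this monomial
    does occur in [ss_la,n], the family is triangular for the dominance
    order. *)
Require Import Defs.
From mathcomp Require Import all_boot all_order all_algebra complex reals.
From mathcomp Require Import finmap.
From mathcomp Require Import boolp classical_sets functions cardinality fsbigop.
From mathcomp Require Import zify.

Set Implicit Arguments.
Unset Strict Implicit.
Unset Printing Implicit Defensive.

Import GRing.Theory Num.Theory.

(** * Partitions, their partial sums and containment *)

Lemma nth_part_noninc (la : intpart) r s :
  r <= s -> nth 0 la s <= nth 0 la r.
Proof.
move=> rs; case: (ltnP s (size la)) => [ss|ss]; last by rewrite nth_default.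
have /andP[sla _] := valP la.
have tr : transitive geq by move=> a b c; rewrite /geq /=; lia.
have rf : reflexive geq by move=> a; rewrite /geq /=.
apply: (sorted_leq_nth tr rf 0 sla r s _ ss rs).
by rewrite inE; apply: leq_ltn_trans ss.
Qed.

Lemma nth_part_gt0 (la : intpart) r : (0 < nth 0 la r) = (r < size la).
Proof.
case: (ltnP r) => [rs|rs]; last by rewrite nth_default.
have /andP[_ zla] := valP la.
rewrite lt0n; apply/eqP => e; case/negP: zla.
by have := mem_nth 0 rs; rewrite e.
Qed.

Lemma intpart_ext (mu la : intpart) : nth 0 mu =1 nth 0 la -> mu = la.
Proof.
move=> e; apply: val_inj; apply: (@eq_from_nth _ 0) => [|i _]; last exact: e.
have h r : (r < size mu) = (r < size la) by rewrite -!nth_part_gt0 e.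
by have h1 := h (size mu); have h2 := h (size la); rewrite /=; lia.
Qed.

Definition partial_sum (la : seq nat) j := \sum_(r < j) nth 0 la r.

Lemma partial_sumS la j :
  partial_sum la j.+1 = partial_sum la j + nth 0 la j.
Proof. by rewrite /partial_sum big_ord_recr. Qed.

Lemma sumn_partial_sum la j : size la <= j -> sumn la = partial_sum la j.
Proof.
move=> sj; rewrite sumnE (big_nth 0) /partial_sum.
rewrite -(big_mkord xpredT (fun r => nth 0 la r)).
rewrite [RHS](big_cat_nat (n := size la)) //= [X in _ = _ + X]big_nat_cond.
rewrite [X in _ = _ + X]big1 ?addn0 //.
by move=> i /andP[/andP[? _] _]; rewrite nth_default.
Qed.

Lemma size_part_le_sumn (la : intpart) : size la <= sumn la.
Proof.
have : 0 \notin parts la by case/andP: (valP la).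
elim: (parts la) => //= a s IH.
by rewrite inE negb_or => /andP[a0 /IH]; lia.
Qed.

(** The rows from index [j] on contribute nonnegatively to |[la]/[mu]|, so its first [j] rows hold
    at most all its boxes. The terms are arranged to avoid truncated subtraction. *)
Lemma partial_sum_sub (mu la : intpart) j : part_sub mu la ->
  partial_sum la j + sumn mu <= partial_sum mu j + sumn la.
Proof.
move=> sub; pose N := maxn (size mu) (size la) + j.
rewrite (@sumn_partial_sum mu N) ?(@sumn_partial_sum la N) /N; try lia.
rewrite addnC; move: (maxn _ _) => M.
elim: M => [|M IH]; first by rewrite add0n addnC.
by rewrite addSn !partial_sumS; have := sub (M + j); lia.
Qed.

Lemma sumn_sub (mu la : intpart) : part_sub mu la -> sumn mu <= sumn la.
Proof.
by move=> /(partial_sum_sub 0); rewrite /partial_sum !big_ord0.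
Qed.

Lemma part_sub_eq (mu la : intpart) :
  part_sub mu la -> sumn la <= sumn mu -> mu = la.
Proof.
move=> sub le; apply: intpart_ext => j.
have := partial_sum_sub j sub; have := partial_sum_sub j.+1 sub.
have : partial_sum mu j <= partial_sum la j by apply: leq_sum => i _; apply: sub.
have := sub j; have := sumn_sub sub.
rewrite !partial_sumS; lia.
Qed.

(** * Box counts along an SSOT *)

Section Ssot.
Variables (mu : intpart) (S : tabseq).
Hypothesis HS : is_ssot mu S.

Let removed i := sumn (S.1 i) - sumn (S.2 i).

Lemma ssot_sumn_le i :
  sumn (S.2 i) <= sumn (S.1 i) /\ sumn (S.2 i) <= sumn (S.1 i.+1).
Proof. by case: HS => _ _ /(_ i)[/sumn_sub ? /sumn_sub ?]. Qed.

(** A step has multiplicity removed plus added, while the size changes by added minus removed; the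
    two differ by twice the removed boxes. *)
Lemma ssot_sumn_mult j :
  sumn (S.1 j) + 2 * \sum_(i < j) removed i = \sum_(i < j) ssot_mult S i.
Proof.
elim: j => [|j IH]; first by rewrite !big_ord0; case: HS => ->.
rewrite !big_ord_recr /= -IH /ssot_mult /skew_size /removed.
have [+ +] := ssot_sumn_le j.
move: (\sum_(i < j) _) (sumn (S.1 j)) (sumn (S.2 j)) (sumn (S.1 j.+1)); lia.
Qed.

(** Each step creates at most one row: two new rows would put two boxes of the added strip in column
    0. *)
Lemma ssot_size_le i : size (S.1 i) <= i.
Proof.
case: HS => S10 _ sub hs _; elim: i => [|i IH]; first by rewrite S10.
rewrite leqNgt -nth_part_gt0; apply/negP => pos.
have z2 r : i <= r -> nth 0 (S.2 i) r = 0.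
  by move=> ir; have := (sub i).1 r; rewrite [X in _ <= X]nth_default; lia.
have [_ /(_ 0 i i.+1)] := hs i.
rewrite /Defs.skew /= !z2 // => h.
have pos' : 0 < nth 0 (S.1 i.+1) i.
  by apply: leq_trans pos _; apply: nth_part_noninc.
by have := h pos' pos; lia.
Qed.

(** After time [j] the first [j] rows lose at most the boxes removed since then, and additions
    cannot decrease them. *)
Lemma ssot_partial_sum j d :
  partial_sum (S.1 j) j <=
  partial_sum (S.1 (j + d)) j + \sum_(j <= i < j + d) removed i.
Proof.
elim: d => [|d IH]; first by rewrite addn0 big_geq // addn0.
rewrite addnS big_nat_recr ?leq_addr //=; apply: leq_trans IH _.
case: HS => _ _ /(_ (j + d))[s1 s2] _ _.
have := partial_sum_sub j s1; have := sumn_sub s1; rewrite /removed.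
have : partial_sum (S.2 (j + d)) j <= partial_sum (S.1 (j + d).+1) j.
  by apply: leq_sum => i _; apply: s2.
lia.
Qed.

(** The hypothesis fixes the length, so [k] boxes are removed in all. Those removed before time [j]
    count twice on the left; those removed later count once, through [ssot_partial_sum]. The total
    is thus at most 2[k]. *)
Lemma ssot_mult_partial_sum k j :
  (exists N0, forall N, N0 <= N ->
     \sum_(i < N) ssot_mult S i = sumn mu + 2 * k) ->
  \sum_(i < j) ssot_mult S i <= partial_sum mu j + minn j 2 * k.
Proof.
case=> N0 HN; case: (HS) => S10 S20 _ _ [N1 st].
pose d := N0 + N1.
have eN : S.1 (j + d) = mu by apply: (st _ _).1; lia.
have := ssot_sumn_mult (j + d); rewrite eN HN; last by lia.
have := ssot_sumn_mult j; have := ssot_partial_sum j d; rewrite eN.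
rewrite (sumn_partial_sum (ssot_size_le j)).
rewrite -!(big_mkord xpredT removed).
have -> : \sum_(0 <= i < j + d) removed i =
    \sum_(0 <= i < j) removed i + \sum_(j <= i < j + d) removed i.
  by rewrite -big_cat_nat ?leq_addr.
(* Nothing can be removed from the empty partition; for [j] = 1 only later removals remain, which
   gives [k] instead of 2[k]. *)
have r0 : removed 0 = 0 by rewrite /removed S10 S20.
clear eN; case: j => [|[|j]]; first by rewrite /= !big_ord0; lia.
  by rewrite big_nat1 r0; lia.
by rewrite (_ : minn j.+2 2 = 2); lia.
Qed.

Lemma ssot_sumn_bound i :
  sumn (S.1 i) <= \sum_(j < i) ssot_mult S j /\
  sumn (S.2 i) <= \sum_(j < i) ssot_mult S j.
Proof.
by have := ssot_sumn_mult i; have := ssot_sumn_le i; lia.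
Qed.

Lemma ssot_const N : (forall i, N <= i -> ssot_mult S i = 0) ->
  forall i, N <= i -> S.1 i = S.1 N /\ S.2 i = S.1 N.
Proof.
move=> H; case: (HS) => _ _ sub _ _.
have st i : N <= i -> S.2 i = S.1 i /\ S.2 i = S.1 i.+1.
  move=> /H; rewrite /ssot_mult /skew_size => e.
  by have [s1 s2] := sub i; split; apply: part_sub_eq => //; lia.
have e1 i : N <= i -> S.1 i = S.1 N.
  elim: i => [|i IH]; first by rewrite leqn0 => /eqP->.
  rewrite leq_eqVlt => /orP[/eqP<- //|Ni]; rewrite -IH //.
  by have [-> ->] := st i Ni.
by move=> i Ni; rewrite (st i Ni).1 e1.
Qed.

End Ssot.

(** * Finiteness of the sets counted by the coefficients *)

Lemma finite_intpart B : finite_set [set la : intpart | sumn la <= B].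
Proof.
(* A partition of size at most [B] has at most [B] parts, each at most [B]; sequences that are not
   partitions go to [intpart0]. *)
pose f (t : {bseq B of 'I_B.+1}) : intpart :=
  insubd intpart0 [seq nat_of_ord x | x <- t].
apply: (@sub_finite_set _ _ (f @` setT)); last exact/finite_image/finite_finset.
move=> la /= sla; have szl := leq_trans (size_part_le_sumn la) sla.
have szb : size [seq inord x : 'I_B.+1 | x <- la] <= B by rewrite size_map.
exists (Bseq szb) => //; apply: val_inj; rewrite /f /=.
have -> : [seq nat_of_ord x | x <- [seq inord x : 'I_B.+1 | x <- la]] = la.
  rewrite -map_comp -[RHS]map_id; apply/eq_in_map => x xla /=.
  rewrite inordK // ltnS; apply: leq_trans sla.
  by rewrite sumnE (big_rem x) //= leq_addr.
by rewrite val_insubd (valP la).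
Qed.

(** Needed because [fset_set] of an infinite set is empty. Beyond the support of [alpha] the SSOT is
    constant, and all its partitions have size at most the degree of [alpha]. *)
Lemma finite_ssot la (alpha : expvec) :
  finite_set [set S : tabseq | is_ssot la S /\
                               forall i, ssot_mult S i = alpha i].
Proof.
pose N := \max_(i <- finsupp alpha) i.+1.
have aN i : N <= i -> alpha i = 0.
  move=> Ni; apply: fsfun_dflt; apply/negP => ia.
  have : i.+1 <= N by rewrite /N; apply: (@leq_bigmax_seq _ _ _ succn).
  lia.
pose B := \sum_(j < N) alpha j.
pose X := [set mu : intpart | sumn mu <= B]%classic.
pose Y := fset_set X.
have YE (mu : intpart) : sumn mu <= B -> mu \in Y.
  by move=> h; rewrite /Y in_fset_set; [exact/mem_set|exact: finite_intpart].
(* Extends finite data on 0, ..., [N] by its last value. *)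
pose g (f : {ffun 'I_N.+1 -> Y} * {ffun 'I_N.+1 -> Y}) : tabseq :=
  (fun i => val (f.1 (inord (minn i N))),
   fun i => val (f.2 (inord (minn i N)))).
apply: (@sub_finite_set _ _ (g @` setT)); last exact/finite_image/finite_finset.
move=> S /= [HS HA].
have bd i : sumn (S.1 (minn i N)) <= B /\ sumn (S.2 (minn i N)) <= B.
  have [b1 b2] := ssot_sumn_bound HS (minn i N).
  suff le : \sum_(j < minn i N) ssot_mult S j <= B.
    by split; apply: leq_trans le.
  rewrite /B (eq_bigr (fun j : 'I__ => alpha j)) => [|j _]; last exact: HA.
  rewrite -!(big_mkord xpredT alpha).
  by rewrite [X in _ <= X](big_cat_nat (n := minn i N)) ?geq_minr //= leq_addr.
pose c1 i : Y := [` YE _ (bd i).1]%fset.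
pose c2 i : Y := [` YE _ (bd i).2]%fset.
exists ([ffun i : 'I_N.+1 => c1 i], [ffun i : 'I_N.+1 => c2 i]) => //.
have cst := ssot_const HS (N := N) (fun i Ni => etrans (HA i) (aN i Ni)).
rewrite /g [RHS]surjective_pairing; congr pair; apply: funext => i;
  rewrite ffunE /= inordK ?ltnS ?geq_minr // -minnA minnn.
  by case: (leqP i N) => // Ni; rewrite (cst i _).1 // ltnW.
by case: (leqP i N) => // Ni; rewrite (cst i _).2 ?(cst N _).2 // ltnW.
Qed.

(** * An SSOT realizing the leading monomial *)

Fact trunc_part_subproof (la : intpart) j :
  sorted geq (take j la) && (0 \notin take j la).
Proof.
have /andP[s z] := valP la; rewrite take_sorted //=.
by apply: contra z => /mem_take.
Qed.
Definition trunc_part la j := IntPart (trunc_part_subproof la j).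

Fact row_part_subproof p :
  sorted geq (nseq (0 < p) p) && (0 \notin nseq (0 < p) p).
Proof. by case: p. Qed.
Definition row_part p := IntPart (row_part_subproof p).

Lemma nth_take0 (la : seq nat) j r :
  nth 0 (take j la) r = if r < j then nth 0 la r else 0.
Proof.
case: ltnP => h; first by rewrite nth_take.
by rewrite nth_default // size_take; case: ltnP => //; lia.
Qed.

Lemma nth_row_part p r : nth 0 (row_part p) r = if r == 0 then p else 0.
Proof. by case: p r => [|p] [|r] //=; rewrite ?nth_nil. Qed.

Lemma sumn_row_part p : sumn (row_part p) = p.
Proof. by case: p => //= p; rewrite addn0. Qed.

Lemma sumn_takeS (la : seq nat) j :
  sumn (take j.+1 la) = sumn (take j la) + nth 0 la j.
Proof.
case: (ltnP j (size la)) => h; last first.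
  by rewrite nth_default // !take_oversize ?addn0 // ltnW.
by rewrite (take_nth 0) // sumn_rcons.
Qed.

(* Fills [la] row by row, with a detour through the row of length
   [la_1 + k] in the first step, undone in the second. *)
Definition detour_ssot (la : intpart) (k : nat) : tabseq :=
  (fun i => if i == 1 then row_part (nth 0 la 0 + k) else trunc_part la i,
   fun i => trunc_part la i).

Lemma detour_ssotP la k : is_ssot la (detour_ssot la k).
Proof.
have t0 : trunc_part la 0 = intpart0.
  by apply: val_inj; rewrite /trunc_part /= take0.
split=> //=; last first.
(* The bound is at least 2, so the detour is over even when [la] is empty. *)
- exists (size la).+2 => i hi; have -> : i == 1 = false by lia.
  by split; apply: val_inj; rewrite /trunc_part /= take_oversize //; lia.
- move=> i; split=> c r1 r2; rewrite /Defs.skew /=.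
  + case: ifP => [/eqP->|_]; last by rewrite !nth_take0; lia.
    by rewrite !nth_row_part; do 2 case: eqP => //; lia.
  + case: ifP => [_|_].
      by rewrite !nth_row_part; do 2 case: eqP => //; lia.
    (* The added strip lies in the single row [i]. *)
    have H r : nth 0 (take i la) r <= c < nth 0 (take i.+1 la) r -> r = i.
      by rewrite !nth_take0; case: (ltnP r i); case: (ltnP r i.+1); lia.
    by move=> /H-> /H->.
- move=> i; split=> r; case: ifP => [/eqP e|_] //;
    rewrite ?nth_row_part !nth_take0.
  + by rewrite e; case: r => //=; lia.
  + by case: r => [|r]; case: ifP => //; lia.
  + by case: ifP; case: ifP => //; lia.
Qed.

Lemma detour_ssot_mult la k i :
  ssot_mult (detour_ssot la k) i = nth 0 la i + (i < 2) * k.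
Proof.
have t0 : sumn (take 0 la) = 0 by rewrite take0.
rewrite /ssot_mult /skew_size /detour_ssot /=.
have := sumn_takeS la 0; have := sumn_takeS la 1.
case: i => [|[|i]] /=; rewrite ?sumn_row_part.
- lia.
- lia.
- by have := sumn_takeS la i.+2; lia.
Qed.

(** The two extra indices ensure that 0 and 1 are covered when [la] has fewer than two rows. *)
Definition leading_exp (la : intpart) (k : nat) : expvec :=
  [fsfun i in [fset j in iota 0 (size la).+2]%fset =>
     nth 0 la i + (i < 2) * k].

Lemma leading_expE la k i : leading_exp la k i = nth 0 la i + (i < 2) * k.
Proof.
have e : (i \in [fset j in iota 0 (size la).+2]%fset) = (i < (size la).+2).
  by rewrite in_fset; exact: mem_iota.
rewrite fsfunE e; case: (ltnP i (size la).+2) => // h.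
by rewrite nth_default; lia.
Qed.

Lemma sum_leading_exp la k j :
  \sum_(i < j) leading_exp la k i = partial_sum la j + minn j 2 * k.
Proof.
elim: j => [|j IH]; first by rewrite /partial_sum !big_ord0.
rewrite big_ord_recr /= IH leading_expE partial_sumS.
by case: j {IH} => [|[|j]]; lia.
Qed.

(** * Coefficients at the leading monomials *)

Section SSCoef.
Local Open Scope ring_scope.
Variables (K : numDomainType) (k : nat).

(** [detour_ssot] is counted, and a positive count stays nonzero in characteristic zero. *)
Lemma ss_leading_neq0 (la : intpart) n : n = (sumn la + 2 * k)%N ->
  @ss K la n (leading_exp la k) != 0.
Proof.
move=> nE; rewrite /ss pnatr_eq0 cardfs_eq0; apply/eqP => e.
set X := [set _ | _]%classic in e.
have fX : finite_set X.
  apply: sub_finite_set (finite_ssot la (leading_exp la k)).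
  by move=> S [].
suff : detour_ssot la k \in fset_set X by rewrite e inE.
rewrite in_fset_set //; apply/mem_set; split=> [||i]; first exact: detour_ssotP.
  rewrite /ssot_length -(@fsbig_widen _ _ _ _ (`I_((size la).+2))) //.
    rewrite -fsbig_ord nE (eq_bigr (fun i : 'I__ => leading_exp la k i)).
      by rewrite sum_leading_exp (@sumn_partial_sum la (size la).+2) ?minnE; lia.
    by move=> i _; rewrite detour_ssot_mult leading_expE.
  by move=> i [_ /= h]; rewrite detour_ssot_mult nth_default; lia.
by rewrite detour_ssot_mult leading_expE.
Qed.

(** Any SSOT counted obeys [ssot_mult_partial_sum], where the terms in [k] on both sides cancel. *)
Lemma ss_leading_dominance (la mu : intpart) n : sumn la = sumn mu ->
    @ss K mu n (leading_exp la k) != 0 ->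
  forall j, (partial_sum la j <= partial_sum mu j)%N.
Proof.
move=> sE; rewrite /ss pnatr_eq0 cardfs_eq0 => /fset0Pn[S].
set X := [set _ | _]%classic.
have fX : finite_set X.
  apply: sub_finite_set (finite_ssot mu (leading_exp la k)).
  by move=> T [].
rewrite in_fset_set // => /set_mem[HS _ HA] j.
have sumE N : (\sum_(i < N) ssot_mult S i = partial_sum la N + minn N 2 * k)%N.
  by rewrite -sum_leading_exp; apply: eq_bigr => i _; apply: HA.
have := @ssot_mult_partial_sum _ _ HS k j; rewrite sumE leq_add2r; apply.
exists (size la).+2 => N hN.
by rewrite sumE -sE (@sumn_partial_sum la N); lia.
Qed.
End SSCoef.

(** * Triangularity and linear independence *)

(** Evaluating a relation at [a i] leaves only the term of [i] and terms of higher rank, whose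
    coefficients vanish by descending induction on the rank. *)
Lemma triangular_lin_indep (K : fieldType) (T : Type) (I : eqType)
    (v : I -> (T -> K^o)) (rank : I -> nat) (a : I -> T) :
    (forall i, v i (a i) != 0)%R ->
    (forall i j, v j (a i) != 0%R -> j != i -> rank i < rank j) ->
  @lin_indep K (T -> K^o) I v.
Proof.
move=> diag tri s c us /(congr1 (fun f => f (a _))) s0 i0.
suff H d i : (\max_(j <- s) rank j) - rank i < d -> i \in s -> c i = 0%R.
  exact: (H _ i0 (ltnSn _)).
elim: d i => // d IH i le is_.
have := s0 i; rewrite fct_sumE (bigD1_seq i) //= big_seq_cond big1 ?addr0.
  by move/eqP; rewrite /GRing.scale /= mulf_eq0 (negPf (diag i)) orbF => /eqP.
move=> j /andP[js ji].
have [e|ne] := eqVneq (v j (a i)) 0%R.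
  by rewrite [LHS](_ : _ = c j * v j (a i))%R // e mulr0.
have lt := tri _ _ ne ji; rewrite IH ?scale0r //.
have : rank j <= \max_(j <- s) rank j by apply: (@leq_bigmax_seq _ _ _ rank).
lia.
Qed.

Theorem theorem4p14 (R : realType) (m n : nat) (hmn : m <= n)
    (hpar : n = m %[mod 2]) :
  lin_indep (fun la : intpart_of m => ss R[i]%C (sval la) n).
Proof.
pose k := (n - m) %/ 2.
have nE : n = m + 2 * k by rewrite /k; lia.
(* The sum of the partial sums serves as rank, being strictly increasing for dominance. *)
apply: (@triangular_lin_indep _ _ _ _
  (fun la : intpart_of m => \sum_(j < m.+1) partial_sum (sval la) j)
  (fun la => leading_exp (sval la) k)) => [la|la mu ne].
  by apply: ss_leading_neq0; rewrite (eqP (valP la)).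
have := ss_leading_dominance _ ne.
rewrite (eqP (valP la)) (eqP (valP mu)) => /(_ erefl) dom neq.
have [eq|//] := leqP (\sum_(j < m.+1) partial_sum (sval mu) j)%N _.
exfalso; case/eqP: neq; apply: val_inj; apply: intpart_ext => r.
have szE (nu : intpart_of m) : size (sval nu) <= m.
  by rewrite -{2}(eqP (valP nu)) size_part_le_sumn.
have [mr|rm] := leqP m r.
  by rewrite !nth_default // (leq_trans (szE _)).
(* Dominance makes every term for [mu] at least that for [la]; one strict inequality would
   contradict [eq]. Consecutive differences then recover the rows. *)
have psE j : j < m.+1 -> partial_sum (sval mu) j = partial_sum (sval la) j.
  move=> jm; apply/eqP; rewrite eqn_leq dom andbT leqNgt; apply/negP => lt.
  suff : \sum_(j < m.+1) partial_sum (sval la) j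
         < \sum_(j < m.+1) partial_sum (sval mu) j by lia.
  rewrite (bigD1 (Ordinal jm)) //= [X in _ < X](bigD1 (Ordinal jm)) //=.
  by rewrite -addSn leq_add // leq_sum.
by have := psE r.+1 rm; rewrite !partial_sumS (psE r (ltnW rm)) => /addnI.
Qed.
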